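(* Let $N\ge 1$, $K\in\{0,\ldots,N\}$, $\mathcal N=\{1,\ldots,N\}$, and fix a slot $t$. For each device $n\in\mathcal N$ let $\widehat{\mathcal J}_n^0(t+1)$ and $\widehat{\mathcal J}_n^1(t+1)$ be its predicted reliability costs under the skip and pull actions, and let $s_n(t)=\widehat{\mathcal J}_n^0(t+1)-\widehat{\mathcal J}_n^1(t+1)$ be its reliability score. Put $s(t)=(s_1(t),\ldots,s_N(t))$, let $\widehat S_t=\operatorname{TopK}_{+}(s(t))$, and define $u^\star(t)\in\{0,1\}^N$ by $u_n^\star(t)=\mathbf 1\{n\in\widehat S_t\}$ for $n=1,\ldots,N$. Then $u^\star(t)$ is an optimal solution of $$\min_{u\in\mathcal U_K}\ \sum_{n=1}^{N}\Big[(1-u_n)\,\widehat{\mathcal J}_n^0(t+1)+u_n\,\widehat{\mathcal J}_n^1(t+1)\Big],\qquad \mathcal U_K=\Big\{u\in\{0,1\}^N:\ \sum_{n=1}^N u_n\le K\Big\}.$$ The pull set $\{n\in\mathcal N: u_n^\star(t)=1\}$ induced by this decision is $\widehat S_t$. Hence $|\widehat S_t|\le K$, and $|\widehat S_t|=K$ only when at least $K$ devices $n$ have $s_n(t)>0$.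
   Context: A base station chooses in each slot $t$ a pull-decision vector $u(t)\in\{0,1\}^N$ with at most $K$ entries equal to one; $u_n=1$ means device $n$ is pulled, $u_n=0$ means it is skipped. Predicted reliability costs: for each device $n$ and action $a\in\{0,1\}$ ($a=0$ skip, $a=1$ pull), $$\widehat{\mathcal J}_n^a(t+1)=\omega_n\Big[\alpha\,\frac{\widehat I_n^a(t+1)}{s_I}+(1-\alpha)\,\frac{\widehat e_n^a(t+1)}{s_e}\Big],$$ where $\omega_n>0$ is a priority weight, $\alpha\in[0,1]$, $s_I>0$ and $s_e>0$ are fixed normalization constants, and $\widehat I_n^a(t+1)\ge 0$, $\widehat e_n^a(t+1)\ge 0$ are given real numbers (predictions of next-slot ensemble disagreement and estimation error, with negative predictions replaced by zero). $\operatorname{TopK}_{+}$: for a vector $x=(x_1,\ldots,x_N)\in\mathbb R^N$, $\operatorname{TopK}_{+}(x)$ is the set of indices of the largest strictly positive entries of $x$, up to the budget $K$. Equivalently, it is a set $$\operatorname{TopK}_{+}(x)\in\arg\max_{S\subseteq\mathcal N,\ |S|\le K}\ \sum_{n\in S}x_n$$ with the convention that indices $n$ with $x_n\le 0$ are not selected (ties are broken arbitrarily). *)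

(* Defs.v *)
From mathcomp Require Import all_boot all_order all_algebra.

Set Implicit Arguments.
Unset Strict Implicit.
Unset Printing Implicit Defensive.

Import Order.TTheory GRing.Theory Num.Theory.
Local Open Scope ring_scope.

(* Devices are indexed by 'I_N and decision vectors of {0,1}^N are finite
   boolean functions; for actions, [true] is pull (1) and [false] is skip (0).
   A predicted quantity [p] is read as [p n a t]: device, action, slot. *)

Definition predicted_cost (R : realFieldType) (N : nat) (omega : 'I_N -> R)
    (alpha s_I s_e : R) (Ihat ehat : 'I_N -> bool -> nat -> R)
    (n : 'I_N) (a : bool) (t : nat) : R :=
  omega n * (alpha * (Ihat n a t / s_I) + (1 - alpha) * (ehat n a t / s_e)).

(* The score at slot [t] compares the costs predicted for slot [t.+1]. *)
Definition score (R : realFieldType) (N : nat) (J : 'I_N -> bool -> nat -> R)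
    (t : nat) (n : 'I_N) : R :=
  J n false t.+1 - J n true t.+1.

(* [S] is an admissible value of TopK_+(x): it consists of the largest strictly
   positive entries of [x], as many of them as the budget [K] allows.  Ties make
   the value non-unique, hence a predicate rather than a function. *)
Definition is_TopKplus (R : realFieldType) (N K : nat) (x : 'I_N -> R)
    (S : {set 'I_N}) : Prop :=
  [/\ forall n, n \in S -> 0 < x n,
      #|S| = minn K #|[set n | 0 < x n]| &
      forall m n, m \in S -> n \notin S -> x n <= x m].

Definition indicator_decision (N : nat) (S : {set 'I_N}) : {ffun 'I_N -> bool} :=
  [ffun n => n \in S].

Definition pull_set (N : nat) (u : {ffun 'I_N -> bool}) : {set 'I_N} :=
  [set n | u n].

(* The sum is in [nat], through the coercion from [bool]. *)
Definition feasible (N K : nat) : {set {ffun 'I_N -> bool}} :=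
  [set u : {ffun 'I_N -> bool} | (\sum_(n < N) u n <= K)%N].

Definition total_cost (R : realFieldType) (N : nat)
    (J : 'I_N -> bool -> nat -> R) (t : nat) (u : {ffun 'I_N -> bool}) : R :=
  \sum_(n < N) ((1 - (u n)%:R) * J n false t.+1 + (u n)%:R * J n true t.+1).

Definition is_minimizer (R : realFieldType) (T : finType) (A : {set T})
    (f : T -> R) (u : T) : Prop :=
  u \in A /\ forall v, v \in A -> f u <= f v.

(* Main.v *)
(* Optimality of the top-K set is Lagrangian: there is a multiplier [c >= 0] for
   the budget such that every selected entry is at least [c], every other entry
   is at most [c], and [c = 0] unless the budget is exhausted.  For any [T] with
   at most [K] elements, the sum over [T] of [x - c] is at most the sum over [S],
   and adding back [c * K] gives the comparison of the sums of [x]. *)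

Require Import Defs.
From mathcomp Require Import all_boot all_order all_algebra.

Set Implicit Arguments.
Unset Strict Implicit.
Unset Printing Implicit Defensive.

Import Order.TTheory GRing.Theory Num.Theory.
Local Open Scope ring_scope.

(** The multiplier is the largest unselected entry when some positive entry is left out, and zero
    otherwise. *)
Lemma TopKplus_threshold (R : realFieldType) (N K : nat) (x : 'I_N -> R)
    (S : {set 'I_N}) :
  is_TopKplus K x S ->
  exists c : R, [/\ 0 <= c, forall n, n \in S -> c <= x n,
    forall n, n \notin S -> x n <= c & c * #|S|%:R = c * K%:R].
Proof.
case=> S_gt0 cardS S_top.
have [/existsP[n0 /andP[n0S xn0]] | noP] :=
    boolP [exists n, (n \notin S) && (0 < x n)].
  have [m mS m_max] := @arg_maxP _ _ _ n0 [pred n | n \notin S] x n0S.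
  exists (x m); split=> [|n nS|n nS|].
  - exact: le_trans (ltW xn0) (m_max n0 n0S).
  - exact: S_top.
  - exact: m_max.
  (* Since [n0] is positive and unselected, [S] is a proper subset of the positive indices, so the
     minimum in [cardS] is [K]. *)
  have : (#|S| < #|[set n | (0 < x n)%R]|)%N.
    apply/proper_card/properP; split; last by exists n0; rewrite ?inE.
    by apply/subsetP=> n nS; rewrite inE S_gt0.
  by rewrite {1}cardS gtn_min ltnn orbF cardS => /ltnW/minn_idPl->.
exists 0; split=> [//|n nS|n nS|]; rewrite ?mul0r //; first exact/ltW/S_gt0.
by rewrite leNgt; apply: contra noP => xn; apply/existsP; exists n; rewrite nS.
Qed.

Lemma TopKplus_sum_max (R : realFieldType) (N K : nat) (x : 'I_N -> R)
    (S T : {set 'I_N}) :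
  is_TopKplus K x S -> (#|T| <= K)%N ->
  \sum_(n in T) x n <= \sum_(n in S) x n.
Proof.
move=> /TopKplus_threshold[c [c_ge0 c_le c_ge cK]] leTK.
have shift (A : {set 'I_N}) :
    \sum_(n in A) x n = \sum_(n in A) (x n - c) + c * #|A|%:R.
  by rewrite sumrB sumr_const mulr_natr subrK.
rewrite !shift cK lerD ?ler_wpM2l ?ler_nat //.
(* Extended by zero to all indices, the sums compare termwise: [x n - c] is nonnegative on [S] and
   nonpositive off it. *)
rewrite big_mkcond [leRHS]big_mkcond ler_sum // => n _.
have [nS|nS] := boolP (n \in S).
  by case: ifP; rewrite ?subr_ge0 ?c_le.
by case: ifP; rewrite ?subr_le0 ?c_ge.
Qed.

(** Skipping every device costs a constant independent of [u], and each pull subtracts a score;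
    minimizing cost thus means maximizing the score sum. *)
Lemma total_cost_score (R : realFieldType) (N : nat)
    (J : 'I_N -> bool -> nat -> R) (t : nat) (u : {ffun 'I_N -> bool}) :
  total_cost J t u =
    \sum_n J n false t.+1 - \sum_(n in pull_set u) score J t n.
Proof.
rewrite /total_cost [X in _ - X]big_mkcond -sumrB; apply: eq_bigr => n _.
rewrite inE /score; case: (u n).
  by rewrite subrr mul0r mul1r add0r subKr.
by rewrite !subr0 mul1r mul0r addr0.
Qed.

Lemma in_feasible (N K : nat) (u : {ffun 'I_N -> bool}) :
  (u \in feasible N K) = (#|pull_set u| <= K)%N.
Proof.
rewrite inE -sum1_card [in RHS]big_mkcond; congr (_ <= _)%N.
by apply: eq_bigr => n _; rewrite inE; case: (u n).
Qed.

Lemma pull_set_indicator (N : nat) (S : {set 'I_N}) :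
  pull_set (indicator_decision S) = S.
Proof. by apply/setP=> n; rewrite inE ffunE. Qed.

Theorem lemma1 (R : realFieldType) (N K : nat)
    (N_ge1 : (1 <= N)%N) (K_le_N : (K <= N)%N)
    (omega : 'I_N -> R) (omega_gt0 : forall n, 0 < omega n)
    (alpha : R) (alpha_01 : 0 <= alpha <= 1)
    (s_I s_e : R) (s_I_gt0 : 0 < s_I) (s_e_gt0 : 0 < s_e)
    (t : nat) (Ihat ehat : 'I_N -> bool -> nat -> R)
    (Ihat_ge0 : forall n a, 0 <= Ihat n a t.+1)
    (ehat_ge0 : forall n a, 0 <= ehat n a t.+1)
    (Shat : {set 'I_N}) :
  let J := predicted_cost omega alpha s_I s_e Ihat ehat in
  let s := score J t in
  let ustar := indicator_decision Shat in
  is_TopKplus K s Shat ->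
  [/\ is_minimizer (feasible N K) (total_cost J t) ustar,
      pull_set ustar = Shat,
      (#|Shat| <= K)%N &
      #|Shat| = K -> (K <= #|[set n | (0 < s n)%R]|)%N].
Proof.
move=> J s ustar topS; have [_ cardS _] := topS.
have leSK : (#|Shat| <= K)%N by rewrite cardS geq_minl.
(* In the last claim, [K] becomes [#|Shat|], a minimum bounded by its second argument. *)
split=> [||//|<-]; [|exact: pull_set_indicator|by rewrite cardS geq_minr].
split=> [|v]; rewrite in_feasible ?pull_set_indicator // => leVK.
by rewrite !total_cost_score pull_set_indicator lerB // (TopKplus_sum_max topS).
Qed.
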